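(* For any finite graph $G=(V,E)$ without isolated vertices, we have $$\nu(G)<d_{\min},$$ where $d_{\min}$ is the minimal vertex degree of $G$. In particular, any graph $G$ with a leaf (a vertex of degree $1$) satisfies $$\nu(G)<1.$$
   Context: All graphs $G=(V,E)$ are finite and simple with nonempty vertex set; $x\sim y$ denotes adjacency. $E^{or}(G)$ is the set of ordered pairs $(x,y)$ with $x\sim y$. A magnetic potential is a map $\sigma:E^{or}(G)\to S^1=\{z\in\mathbb{C}:|z|=1\}$ with $\sigma(y,x)=\sigma(x,y)^{-1}$. The magnetic Laplacian on functions $f:V\to\mathbb{C}$ is $\Delta^\sigma f(x)=\sum_{y\sim x}(f(x)-\sigma(x,y)f(y))$, and $\lambda_1^\sigma(G)$ is its smallest eigenvalue. The magneto-spectral height is $\nu(G)=\sup_\sigma\lambda_1^\sigma(G)$, over all magnetic potentials. *)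

(* Defs.v *)
From HB Require Import structures.
From mathcomp Require Import all_boot all_order all_algebra.
From mathcomp Require Import complex.
From mathcomp Require Import boolp classical_sets reals.

Set Implicit Arguments.
Unset Strict Implicit.
Unset Printing Implicit Defensive.

Import Order.TTheory GRing.Theory Num.Theory.

Local Open Scope ring_scope.
Local Open Scope complex_scope.
Local Open Scope classical_set_scope.

Record sgraph := SGraph {
  vertex :> finType;
  adj : rel vertex;
  adj_sym : symmetric adj;
  adj_irrefl : irreflexive adj;
  vertex_gt0 : (0 < #|vertex|)%N }.

Definition degree (G : sgraph) (x : G) : nat := #|[pred y | adj x y]|.

(* Every degree is smaller than #|G|, so the default value of the iterated
   minimum is never reached (G is nonempty). *)
Definition min_degree (G : sgraph) : nat := \big[minn/#|G|]_(x : G) degree x.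

Definition no_isolated (G : sgraph) : Prop :=
  forall x : G, exists y : G, adj x y.

Definition has_leaf (G : sgraph) : Prop := exists x : G, degree x = 1%N.

Section MagneticLaplacian.
Variables (R : realType) (G : sgraph).

(* A potential is encoded as a total function of two vertices, constrained
   only on adjacent pairs: the values elsewhere are irrelevant, since the
   Laplacian only reads sigma on adjacent pairs. *)
Definition magnetic_potential (sigma : G -> G -> R[i]) : Prop :=
  forall x y, adj x y -> `|sigma x y| = 1 /\ sigma y x = (sigma x y)^-1.

(* R[i] is also a vector space over R; the regular module R[i]^o selects the
   structure of vector space over the complex numbers. *)
Definition magnetic_laplacian (sigma : G -> G -> R[i])
    (f : {ffun G -> R[i]^o}) : {ffun G -> R[i]^o} :=
  [ffun x => \sum_(y | adj x y) (f x - sigma x y * f y)].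

Fact magnetic_laplacian_linear sigma : linear (magnetic_laplacian sigma).
Proof.
move=> a f g; apply/ffunP => x; rewrite !ffunE scaler_sumr -big_split /=.
apply: eq_bigr => y _; rewrite !ffunE /GRing.scale /=.
by rewrite mulrDr mulrBr opprD addrACA [sigma x y * (a * _)]mulrCA.
Qed.

HB.instance Definition _ sigma := GRing.isLinear.Build _ _ _ _
  (magnetic_laplacian sigma) (magnetic_laplacian_linear sigma).

(* The Laplacian of a magnetic potential is Hermitian: its complex spectrum is
   real, finite and nonempty, and this infimum is its minimum. *)
Definition lambda1 (sigma : G -> G -> R[i]) : R :=
  inf [set r : R | passmx.leigenvalue (linfun (magnetic_laplacian sigma)) r%:C].

(* This supremum is over a nonempty set (sigma = 1 is a potential) that is
   bounded above, since lambda1 sigma is at most the degree of any vertex. *)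
Definition nu : R := sup [set lambda1 sigma | sigma in magnetic_potential].

End MagneticLaplacian.

(* Main.v *)
Require Import Defs.
From mathcomp Require Import all_boot all_order all_algebra.
From mathcomp Require Import reals.
From mathcomp Require Import complex spectral sesquilinear.
From mathcomp Require Import ring.

(** The smallest eigenvalue of the Laplacian is at most the Rayleigh quotient
    of any nonzero test function, so a strict bound on the supremum over all
    potentials follows from test functions whose Rayleigh quotient does not
    depend on the potential. On an edge x ~ y, with d and D the degrees of x
    and y, take the function supported on {x, y} with value D at x and
    sigma(y,x) at y. The phase at y cancels the one of the potential along the
    edge: the quadratic form is D^2 d - 2 D + D, the squared norm is D^2 + 1,
    and the quotient is

      (D^2 d - D) / (D^2 + 1) = d - (d + D) / (D^2 + 1) < d.

    This gap is uniform in the potential, so it survives the supremum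
    ([nu_lt_degree]). Applying it to a vertex of minimal degree and to a leaf
    gives the two claims.

    The variational principle is proved for Hermitian matrices by unitary
    diagonalization ([hermitian_eigenvalue_le_Rayleigh]) and transported to the
    Laplacian through its matrix in the basis of point masses. As the smallest
    eigenvalue is an infimum of real numbers, a lower bound on the spectrum is
    needed as well; it is 0, by a Gershgorin argument
    ([leigenvalue_laplacian_ge0]). *)

Set Implicit Arguments.
Unset Strict Implicit.
Unset Printing Implicit Defensive.

Import Order.TTheory GRing.Theory Num.Theory.

Local Open Scope ring_scope.
Local Open Scope sesquilinear_scope.

(** * The variational principle for Hermitian matrices *)

Lemma mulmx_diag_quadratic (C : numClosedFieldType) (n : nat) (d w : 'rV[C]_n) :
  (w *m diag_mx d *m w ^t*) 0 0 = \sum_j d 0 j * `|w 0 j| ^+ 2.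
Proof.
rewrite mxE; apply: eq_bigr => j _.
by rewrite mul_mx_diag !mxE normCK mulrAC mulrC mulrA.
Qed.

(** In an orthonormal eigenbasis with eigenvalues d_j, the quadratic form of A
    minus c times the squared norm is the sum of the (d_j - c) |w_j|^2, which
    would be positive if all d_j exceeded c. *)
Lemma hermitian_eigenvalue_le_Rayleigh (C : numClosedFieldType) (n : nat)
    (A : 'M[C]_n) (v : 'rV[C]_n) (c : C) :
  A \is hermsymmx -> v != 0 -> c \is Num.real ->
  (v *m A *m v ^t*) 0 0 <= c * (v *m v ^t*) 0 0 ->
  exists2 r : C, r \is Num.real /\ r <= c & eigenvalue A r.
Proof.
move=> hA v0 cR.
have /orthomx_spectralP AE := hermitian_normalmx hA.
have PU := spectral_unitarymx A.
have Pu := spectral_unit A.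
set P := spectralmx A in AE PU Pu.
set d := spectral_diag A in AE.
have d_real j : d 0 j \is Num.real.
  exact: (mxOverP (hermitian_spectral_diag_real hA)).
have PV : invmx P = P ^t* by apply: invmx_unitary.
(* The coordinates of v in the eigenbasis. *)
pose w := v *m P ^t*.
have vE : v = w *m P by rewrite /w -PV mulmxKV.
have wtE : w ^t* = P *m v ^t*.
  by rewrite /w trmx_mul map_mxM trmxCK.
(* Norm and quadratic form are both diagonal forms in w. *)
have -> : v *m v ^t* = w *m diag_mx (const_mx 1) *m w ^t*.
  by rewrite diag_const_mx mulmx1 wtE mulmxA -vE.
have -> : v *m A *m v ^t* = w *m diag_mx d *m w ^t*.
  by rewrite AE PV !mulmxA wtE mulmxA.
rewrite !mulmx_diag_quadratic.
under [X in _ <= c * X]eq_bigr do rewrite mxE mul1r.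
rewrite mulr_sumr -subr_le0 -sumrB => le_vc.
have [j dj] : exists j, d 0 j <= c.
  apply/existsP; apply: contraT => /existsPn nle.
  have gt j : 0 < d 0 j - c by rewrite subr_gt0 real_ltNge.
  have /rV0Pn[k wk] : w != 0.
    by apply: contra_neq v0 => w0; rewrite vE w0 mul0mx.
  suff /lt_geF <- : 0 < \sum_i (d 0 i * `|w 0 i| ^+ 2 - c * `|w 0 i| ^+ 2).
    exact: le_vc.
  rewrite (bigD1 k) //= ltr_wpDr // -?mulrBl.
    apply: sumr_ge0 => i _; rewrite -mulrBl mulr_ge0 ?exprn_ge0 //.
    exact: ltW.
  by rewrite mulr_gt0 // exprn_gt0 // normr_gt0.
exists (d 0 j) => //.
apply/eigenvalueP; exists (row j P).
  rewrite AE !mulmxA -row_mul mulmxV // row1 -rowE row_diag_mx -scalemxAl.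
  by rewrite -rowE.
apply: contraTneq Pu => Pj.
have : row j (P *m invmx P) = 0 by rewrite row_mul Pj mul0mx.
apply: contra_eqN => Pu.
rewrite mulmxV // row1; apply/eqP => /rowP/(_ j).
by rewrite !mxE !eqxx => /eqP; rewrite oner_eq0.
Qed.

Lemma leigenvalueP (F : fieldType) (V : vectType F) (phi : {linear V -> V})
    (a : F) :
  reflect (exists2 v, phi v = a *: v & v != 0)
    (passmx.leigenvalue (linfun phi) a).
Proof.
rewrite /passmx.leigenvalue -subv0.
have kerE v : (v \in passmx.leigenspace (linfun phi) a) = (phi v == a *: v).
  rewrite memv_ker add_lfunE opp_lfunE scale_lfunE id_lfunE lfunE /=.
  by rewrite subr_eq0.
apply: (iffP idP) => [/subvPn[v]|[v]].
  by rewrite kerE memv0 => /eqP; exists v.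
by move=> /eqP va v0; apply/subvPn; exists v; rewrite ?kerE ?memv0.
Qed.

(** * The Laplacian as a Hermitian matrix *)

Section Potential.
Variables (R : realType) (G : sgraph) (sigma : G -> G -> R[i]).
Hypothesis sigmaP : magnetic_potential sigma.

(** Matrices act on row vectors from the right here, so this is the transpose of
    the usual matrix of the Laplacian: for adjacent u and v, the entry
    in row u and column v is - sigma(v,u). *)
Definition laplacian_mx : 'M[R[i]]_#|G| :=
  \matrix_(i, j) ((degree (enum_val j))%:R *+ (i == j) -
    (if adj (enum_val j) (enum_val i)
     then sigma (enum_val j) (enum_val i) else 0)).

Lemma magnetic_laplacianE (f : {ffun G -> R[i]^o}) x :
  magnetic_laplacian sigma f x =
  (degree x)%:R * f x - \sum_(y | adj x y) sigma x y * f y.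
Proof.
by rewrite ffunE sumrB sumr_const mulr_natl.
Qed.

Lemma row_mul_laplacian_mx (u : 'rV[R[i]]_#|G|) x :
  (u *m laplacian_mx) 0 (enum_rank x) =
  magnetic_laplacian sigma [ffun y => u 0 (enum_rank y)] x.
Proof.
rewrite magnetic_laplacianE ffunE mxE.
under eq_bigr do rewrite mxE mulrBr enum_rankK.
rewrite sumrB (bigD1 (enum_rank x)) //= eqxx mulr1n mulrC big1 ?addr0; last first.
  by move=> j /negPf ->; rewrite mulr0n mulr0.
congr (_ - _).
rewrite (reindex (@enum_rank G)) /=; last first.
  by apply: onW_bij; exact: enum_rank_bij.
rewrite [RHS]big_mkcond; apply: eq_bigr => y _; rewrite enum_rankK ffunE.
by case: ifP => _; rewrite ?mulr0 // mulrC.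
Qed.

Lemma leigenvalue_laplacian r :
  eigenvalue laplacian_mx r ->
  passmx.leigenvalue (linfun (magnetic_laplacian sigma)) r.
Proof.
move=> /eigenvalueP[u uA u0].
pose f : {ffun G -> R[i]^o} := [ffun y => u 0 (enum_rank y)].
apply/leigenvalueP; exists f.
  apply/ffunP => x; rewrite /= -row_mul_laplacian_mx uA !ffunE.
  by rewrite !mxE.
apply: contra_neq u0 => f0; apply/rowP => j.
by have /ffunP/(_ (enum_val j)) := f0; rewrite !ffunE enum_valK !mxE.
Qed.

Lemma sigma_conj x y : adj x y -> (sigma x y)^* = sigma y x.
Proof.
by move=> /sigmaP[s1 ->]; rewrite [RHS]invC_norm s1 expr1n invr1 mul1r.
Qed.

(** This is where the constraint sigma(y,x) = sigma(x,y)^-1 enters: on the unit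
    circle, inversion is conjugation. *)
Lemma laplacian_mx_hermitian : laplacian_mx \is hermsymmx.
Proof.
apply/is_hermitianmxP; rewrite expr0 scale1r.
apply/matrixP => i j; rewrite !mxE rmorphB rmorphMn /= rmorph_nat eq_sym.
congr (_ - _); first by case: eqVneq => // ->.
rewrite adj_sym; case: ifP => [aij|]; last by rewrite rmorph0.
by rewrite sigma_conj.
Qed.

(** At a vertex x where an eigenfunction f has maximal modulus, the eigenvalue
    equation bounds |d(x) - r| |f(x)| by the sum of |f| over the d(x) neighbours
    of x, hence by d(x) |f(x)|. *)
Lemma leigenvalue_laplacian_ge0 (r : R) :
  passmx.leigenvalue (linfun (magnetic_laplacian sigma)) r%:C%C -> 0 <= r.
Proof.
move=> /leigenvalueP[f /= fE f0].
have /existsP[x0 fx0] : [exists x, f x != 0].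
  apply: contraNT f0 => /existsPn f0; apply/eqP/ffunP => x.
  by have := f0 x; rewrite negbK ffunE => /eqP.
have [x _ fmax] := @real_arg_maxP _ _ x0 predT (fun x => `|f x|) isT
  (fun x _ => normr_real (f x)).
have fx : 0 < `|f x|.
  by apply: lt_le_trans (fmax x0 isT); rewrite normr_gt0.
have /ffunP/(_ x) := fE; rewrite magnetic_laplacianE ffunE => fxE.
have {}fxE : ((degree x)%:R - r%:C%C) * f x = \sum_(y | adj x y) sigma x y * f y.
  by rewrite mulrBl -[r%:C%C * _]fxE subKr.
have : `|(degree x)%:R - r%:C%C| * `|f x| <= (degree x)%:R * `|f x|.
  rewrite -normrM fxE mulr_natl -sumr_const.
  apply: le_trans (ler_norm_sum _ _ _) _; apply: ler_sum => y xy.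
  by rewrite normrM (sigmaP xy).1 mul1r; apply: fmax.
rewrite ler_pM2r // => le_d.
have rR : r%:C%C \is Num.real by apply/complex_realP; exists r.
have : (degree x)%:R - r%:C%C <= (degree x)%:R.
  by apply: le_trans le_d; apply: real_ler_norm; rewrite rpredB // realn.
by rewrite gerBl ler0c.
Qed.

Lemma lambda1_le_Rayleigh (v : 'rV[R[i]]_#|G|) (c : R) : v != 0 ->
  (v *m laplacian_mx *m v ^t*) 0 0 <= c%:C%C * (v *m v ^t*) 0 0 ->
  lambda1 sigma <= c.
Proof.
move=> v0 vc.
have cR : c%:C%C \is Num.real by apply/complex_realP; exists c.
have [r [/complex_realP[s ->] sc] rA] :=
  hermitian_eigenvalue_le_Rayleigh laplacian_mx_hermitian v0 cR vc.
rewrite lecR in sc; apply: le_trans sc; apply: ge_inf.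
  by exists 0 => t /= /leigenvalue_laplacian_ge0.
exact: leigenvalue_laplacian.
Qed.

(** * A test function on an edge *)

(** The bound is the Rayleigh quotient of D delta_x + sigma(y,x) delta_y, with D
    the degree of y. The ratio 1/D of the moduli makes the gain 2 D from the
    edge exceed the cost D of the value at y, whatever the degree of x. *)
Lemma lambda1_le_edge (x y : G) : adj x y ->
  lambda1 sigma <=
  (degree x)%:R - ((degree x)%:R + (degree y)%:R) / ((degree y)%:R ^+ 2 + 1).
Proof.
move=> xy; set d : R := (degree x)%:R; set D : R := (degree y)%:R.
have xNy : x != y by apply: contraTneq xy => ->; rewrite adj_irrefl.
pose i := enum_rank x; pose j := enum_rank y; pose s := sigma y x.
have ij : i != j by apply: contra_neq xNy => /enum_rank_inj.
pose v : 'rV[R[i]]_#|G| := (D%:C%C) *: delta_mx 0 i + s *: delta_mx 0 j.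
have yx : adj y x by rewrite adj_sym.
have ss : s * s^* = 1 by rewrite -normCK (sigmaP yx).1 expr1n.
apply: (@lambda1_le_Rayleigh v).
  apply/rV0Pn; exists j; rewrite !mxE !eqxx /= [j == i]eq_sym (negPf ij).
  by rewrite mulr0 add0r mulr1 -normr_gt0 (sigmaP yx).1 ltr01.
have vt : v ^t* = D%:C%C *: delta_mx i 0 + s^* *: delta_mx j 0.
  apply/matrixP => k l; rewrite !mxE rmorphD !rmorphM /= !rmorph_nat.
  by rewrite ![(l == 0) && _]andbC.
have vM (u : 'rV[R[i]]_#|G|) :
    (u *m v ^t*) 0 0 = D%:C%C * u 0 i + s^* * u 0 j.
  by rewrite vt mulmxDr -!scalemxAr -!colE !mxE.
(* Only the four entries of the matrix at x and y contribute. *)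
rewrite !vM mulmxDl -!scalemxAl -!rowE !mxE !eqxx !enum_rankK.
rewrite !adj_irrefl xy yx [j == i]eq_sym (negPf ij) /=.
rewrite !mulr0n !mulr1n -/s -(sigma_conj yx) -/s.
have -> : D%:C%C * (D%:C%C * ((degree x)%:R - 0) + s * (0 - s^* )) +
    s^* * (D%:C%C * (0 - s) + s * ((degree y)%:R - 0)) =
    (D ^+ 2 * d - D)%:C%C.
  rewrite -!(rmorph_nat (real_complex R)) -/d -/D rmorphB rmorphM rmorphXn /=.
  by ring: ss.
have -> : D%:C%C * (D%:C%C * 1 + s * 0) + s^* * (D%:C%C * 0 + s * 1) =
    (D ^+ 2 + 1)%:C%C.
  by rewrite rmorphD rmorphXn rmorph1 /=; ring: ss.
rewrite -rmorphM lecR le_eqVlt; apply/orP; left; apply/eqP.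
have D0 : D ^+ 2 + 1 != 0 by rewrite gt_eqF // ltr_wpDl // sqr_ge0.
by field.
Qed.

End Potential.

(** The bound on the smallest eigenvalue involves only the degrees, not the
    potential, so it remains strict after taking the supremum. *)
Lemma nu_lt_degree (R : realType) (G : sgraph) (x y : G) :
  adj x y -> nu R G < (degree x)%:R.
Proof.
move=> xy; set d : R := (degree x)%:R; set D : R := (degree y)%:R.
have yx : adj y x by rewrite adj_sym.
have Dgt0 : 0 < D by rewrite ltr0n; apply/card_gt0P; exists x.
apply: (@le_lt_trans _ _ (d - (d + D) / (D ^+ 2 + 1))); last first.
  by rewrite gtrBl divr_gt0 ?ltr_wpDl ?sqr_ge0 ?ler0n.
(* The supremum is over a nonempty set, thanks to the trivial potential. *)
apply: ge_sup.
  exists (lambda1 (fun _ _ : G => 1 : R[i])); exists (fun _ _ => 1) => //.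
  by move=> u v _; rewrite normr1 invr1.
by move=> _ [sigma sigmaP <-]; apply: lambda1_le_edge.
Qed.

(** The default value #|G| of the iterated minimum dominates all degrees, so it
    does not hide the minimum. *)
Lemma min_degree_attained (G : sgraph) : exists x : G, min_degree G = degree x.
Proof.
have /card_gt0P[x0 _] := vertex_gt0 G.
have deg_le (x : G) : true -> (degree x <= #|G| :> nat)%O.
  by rewrite leEnat max_card.
have [x _ xE] := eq_bigmin x0 xpredT _ isT deg_le.
by exists x; rewrite -xE minEnat.
Qed.

Theorem corollary3p6 (R : realType) (G : sgraph) :
  (no_isolated G -> nu R G < (min_degree G)%:R) /\
  (has_leaf G -> nu R G < 1).
Proof.
split=> [noiso|[x x1]].
  have [x ->] := min_degree_attained G.
  by have [y xy] := noiso x; apply: nu_lt_degree xy.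
have /card_gt0P[y xy] : (0 < degree x)%N by rewrite x1.
by have := @nu_lt_degree R G x y xy; rewrite x1.
Qed.
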